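(* For any positive integer $m$, the following three identities hold: $$\sum_{j=1}^{2m-1}\frac{1}{\frac{1}{4}+\sin^{2}\frac{j\pi}{2m}}=\frac{4}{5}\cdot\frac{(2m-1)F_{2m+1}+(2m+1)F_{2m-1}}{F_{2m}}-\frac{16}{5},$$ $$\sum_{j=0}^{2m-1}\frac{1}{1+4\sin^{2}\frac{j\pi}{2m}}=\frac{2mL_{2m}}{5F_{2m}},$$ $$\sum_{j=0}^{2m-1}\frac{1}{1+\sin^{2}\frac{j\pi}{2m}}=\frac{mQ_{2m}}{P_{2m}}.$$
   Context: $F_n$ and $L_n$ are the Fibonacci and Lucas numbers: $F_0=0$, $F_1=1$, $F_n=F_{n-1}+F_{n-2}$ and $L_0=2$, $L_1=1$, $L_n=L_{n-1}+L_{n-2}$ for $n\ge 2$. The Fibonacci and Lucas polynomials are defined by $F_0(x)=0$, $F_1(x)=1$, $F_n(x)=xF_{n-1}(x)+F_{n-2}(x)$ and $L_0(x)=2$, $L_1(x)=x$, $L_n(x)=xL_{n-1}(x)+L_{n-2}(x)$ for $n\ge 2$. The Pell numbers are $P_n=F_n(2)$ and the Pell-Lucas numbers are $Q_n=\frac12 L_n(2)$ (note the factor $\frac12$). *)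

(* Defs.v *)
From mathcomp Require Import all_boot all_order all_algebra.

Set Implicit Arguments.
Unset Strict Implicit.
Unset Printing Implicit Defensive.

Import GRing.Theory.
Local Open Scope ring_scope.

Fixpoint fibonacci (n : nat) : nat :=
  match n with
  | 0 => 0
  | 1 => 1
  | (n1.+1 as n2).+1 => fibonacci n2 + fibonacci n1
  end%N.

Fixpoint lucas (n : nat) : nat :=
  match n with
  | 0 => 2
  | 1 => 1
  | (n1.+1 as n2).+1 => lucas n2 + lucas n1
  end%N.

Fixpoint fibonacci_poly (R : nzRingType) (n : nat) : {poly R} :=
  match n with
  | 0%N => 0
  | 1%N => 1
  | (n1.+1 as n2).+1 => 'X * fibonacci_poly R n2 + fibonacci_poly R n1
  end.

Fixpoint lucas_poly (R : nzRingType) (n : nat) : {poly R} :=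
  match n with
  | 0%N => 2%:R
  | 1%N => 'X
  | (n1.+1 as n2).+1 => 'X * lucas_poly R n2 + lucas_poly R n1
  end.

Definition pell (R : nzRingType) (n : nat) : R := (fibonacci_poly R n).[2%:R].

(* Half of the companion Pell numbers 2, 2, 6, 14, ...: the values here are
   1, 1, 3, 7, ... *)
Definition pell_lucas (R : unitRingType) (n : nat) : R :=
  2%:R^-1 * (lucas_poly R n).[2%:R].

(* Main.v *)
(* With q = a^2, r = b^2, where a, b are the roots of t^2 - x t - 1, each summand
   1 / (x^2 + 4 sin^2 (j pi / N)) is the Poisson kernel 1 / (q + r - 2 cos t_j)
   at t_j = 2 pi j / N. For such angles the kernel is, up to a constant, the finite
   cosine sum of r^k + r^(N - k) times cos (k t_j) over k < N, and summing over j
   kills every term but k = 0. For even N the result is expressed by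
   F_N(x) and L_N(x) through the Binet formulas. *)
Require Import Defs.
From mathcomp Require Import all_boot all_order all_algebra.
From mathcomp Require Import ring lra.
From mathcomp Require Import reals trigo.

Import Order.TTheory GRing.Theory Num.Theory.
Local Open Scope ring_scope.

(** * Values of Fibonacci and Lucas polynomials *)

Lemma horner_fibonacci_polySS (R : comNzRingType) (x : R) n :
  (fibonacci_poly R n.+2).[x] =
  x * (fibonacci_poly R n.+1).[x] + (fibonacci_poly R n).[x].
Proof. by rewrite [fibonacci_poly R n.+2]/= hornerD hornerM hornerX. Qed.

Lemma horner_lucas_polySS (R : comNzRingType) (x : R) n :
  (lucas_poly R n.+2).[x] =
  x * (lucas_poly R n.+1).[x] + (lucas_poly R n).[x].
Proof. by rewrite [lucas_poly R n.+2]/= hornerD hornerM hornerX. Qed.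

(** Since [a * b = -1], both [a] and [b] are roots of t^2 - (a + b) t - 1, so their powers obey the
    recurrence at x = a + b. Multiplying by [a - b] instead of dividing keeps the formula valid in
    any commutative ring. *)
Lemma fibonacci_poly_binet (R : comNzRingType) (a b : R) n : a * b = -1 ->
  (fibonacci_poly R n).[a + b] * (a - b) = a ^+ n - b ^+ n.
Proof.
move=> ab; elim/ltn_ind: n => -[|[|n]] IH.
- by rewrite /= horner0 mul0r !expr0 subrr.
- by rewrite /= hornerC mul1r !expr1.
rewrite horner_fibonacci_polySS mulrDl -mulrA !IH // !exprS.
by ring: ab.
Qed.

Lemma lucas_poly_binet (R : comNzRingType) (a b : R) n : a * b = -1 ->
  (lucas_poly R n).[a + b] = a ^+ n + b ^+ n.
Proof.
move=> ab; elim/ltn_ind: n => -[|[|n]] IH.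
- by rewrite /= -polyC_natr hornerC !expr0.
- by rewrite /= hornerX !expr1.
rewrite horner_lucas_polySS !IH // !exprS.
by ring: ab.
Qed.

Lemma horner_fibonacci_poly1 (R : comNzRingType) n :
  (fibonacci_poly R n).[1] = (fibonacci n)%:R.
Proof.
elim/ltn_ind: n => -[|[|n]] IH; rewrite ?horner0 ?hornerC //.
by rewrite horner_fibonacci_polySS !IH // mul1r -natrD.
Qed.

Lemma horner_lucas_poly1 (R : comNzRingType) n :
  (lucas_poly R n).[1] = (lucas n)%:R.
Proof.
elim/ltn_ind: n => -[|[|n]] IH; first by rewrite /= -polyC_natr hornerC.
  by rewrite hornerX.
by rewrite horner_lucas_polySS !IH // mul1r -natrD.
Qed.

Lemma horner_fibonacci_poly_gt0 (R : numDomainType) (x : R) n :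
  0 < x -> (0 < n)%N -> 0 < (fibonacci_poly R n).[x].
Proof.
move=> x_gt0; elim/ltn_ind: n => -[|[|n]] IH _ //; first by rewrite hornerC.
rewrite horner_fibonacci_polySS; case: n IH => [|n] IH.
  by rewrite horner0 addr0 mulr_gt0 // IH.
by rewrite addr_gt0 ?mulr_gt0 ?IH.
Qed.

Lemma lucas_fibonacci n : lucas n.+1 = (fibonacci n.+2 + fibonacci n)%N.
Proof.
elim/ltn_ind: n => -[|[|n]] IH //.
rewrite -[lucas _]/(lucas n.+2 + lucas n.+1)%N !IH //.
rewrite -[fibonacci n.+4]/(fibonacci n.+3 + fibonacci n.+2)%N.
rewrite -[fibonacci n.+2 in RHS]/(fibonacci n.+1 + fibonacci n)%N.
by rewrite addnACA.
Qed.

(** * Finite cosine sums and the Poisson kernel *)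

Section CosineSums.
Context {R : realType}.
Implicit Types (t q r A : R) (j k n N : nat).

Lemma cos_nat2pi n : cos (n%:R * (pi * 2)) = 1 :> R.
Proof.
elim: n => [|n IH]; first by rewrite mul0r cos0.
by rewrite -(natr1 n) mulrDl mul1r [X in _ + X]mulr_natr cosD2pi.
Qed.

Lemma sin_nat2pi n : sin (n%:R * (pi * 2)) = 0 :> R.
Proof.
by apply/eqP; rewrite -sqrf_eq0 sin2cos2 cos_nat2pi expr1n subrr.
Qed.

(* Any solution u_k = r^k + A q^k of u_(k+1) + u_(k-1) = (q + r) u_k can be paired
   with cos (k t); the right-hand side is a difference of discrete Wronskians. *)
Lemma sum_geometric_cos t q r A n : q * r = 1 ->
  (q + r - 2 * cos t) *
    \sum_(0 <= k < n) (r ^+ k + A * q ^+ k) * cos (k%:R * t) =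
  (r ^+ n + A * q ^+ n) * cos (n%:R * t - t)
  - (q * r ^+ n + A * r * q ^+ n) * cos (n%:R * t)
  - ((1 + A) * cos t - q - A * r).
Proof.
move=> qr1; elim: n => [|n IH].
  by rewrite big_geq // mul0r sub0r cosN cos0 !expr0; ring.
have -> : n.+1%:R * t = n%:R * t + t by rewrite -natr1 mulrDl mul1r.
rewrite big_nat_recr //= mulrDr IH addrK cosB cosD !exprS.
by ring: qr1.
Qed.

(** With h = k pi / N, the factor 2 sin h turns the sum into a telescoping one, and 0 < k < N places
    h strictly between 0 and pi, so this factor can be cancelled. *)
Lemma sum_cos_eq0 N k : (0 < k < N)%N ->
  \sum_(0 <= j < N) cos (k%:R * (j%:R * (pi * 2) / N%:R)) = 0 :> R.
Proof.
move=> /andP[k_gt0 k_ltN].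
have N_gt0 : 0 < N%:R :> R by rewrite ltr0n (leq_trans _ k_ltN).
pose h : R := k%:R * pi / N%:R.
have sin_neq0 : sin h != 0.
  rewrite gt_eqF // sin_gt0_pi //; apply/andP; split.
    by rewrite divr_gt0 // mulr_gt0 ?ltr0n ?pi_gt0.
  by rewrite ltr_pdivrMr // mulrC ltr_pM2l ?pi_gt0 // ltr_nat.
have telescope n : 2 * sin h * (\sum_(0 <= j < n) cos (j%:R * (h * 2))) =
    sin (n%:R * (h * 2) - h) + sin h.
  elim: n => [|n IH]; first by rewrite big_geq // mulr0 mul0r sub0r sinN addNr.
  have -> : n.+1%:R * (h * 2) - h = n%:R * (h * 2) + h by rewrite -(natr1 n); ring.
  by rewrite big_nat_recr //= mulrDr IH sinB sinD; ring.
have sin2_neq0 : 2 * sin h != 0 by rewrite mulf_neq0 ?pnatr_eq0.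
apply: (mulfI sin2_neq0).
rewrite (eq_bigr (fun j => cos (j%:R * (h * 2)))) => [|j _]; last first.
  by congr cos; rewrite /h; field; lra.
rewrite telescope mulr0.
have -> : N%:R * (h * 2) - h = k%:R * (pi * 2) - h by rewrite /h; field; lra.
by rewrite sinB sin_nat2pi cos_nat2pi; ring.
Qed.

(** The choice A = r^N in [sum_geometric_cos] gives A q^N = 1. As N t is a multiple of 2 pi, the cos
    t terms then cancel and the right-hand side becomes the constant (q - r)(1 - r^N). *)
Lemma poisson_kernel_expansion N j q r : (0 < N)%N -> 1 < q -> q * r = 1 ->
  let t := j%:R * (pi * 2) / N%:R in
  1 / (q + r - 2 * cos t) =
  (\sum_(0 <= k < N) (r ^+ k + r ^+ N * q ^+ k) * cos (k%:R * t))
    / ((q - r) * (1 - r ^+ N)).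
Proof.
move=> N_gt0 q_gt1 qr1 t.
have N_neq0 : N%:R != 0 :> R by rewrite pnatr_eq0 -lt0n.
have r_gt0 : 0 < r by rewrite -(pmulr_rgt0 _ (lt_trans ltr01 q_gt1)) qr1.
have r_lt1 : r < 1 by nra.
have rN_lt1 : r ^+ N < 1 by rewrite exprn_ilt1 ?ltW -?lt0n.
have qrN : q ^+ N * r ^+ N = 1 by rewrite -exprMn qr1 expr1n.
have Nt : N%:R * t = j%:R * (pi * 2) by rewrite /t; field.
have := sum_geometric_cos t q r (r ^+ N) N qr1.
rewrite Nt cosB cos_nat2pi sin_nat2pi => sumE.
(* Here q + r - 2 = (q - 1)(1 - r) > 0. *)
have den_gt0 : 0 < q + r - 2 * cos t by have := cos_le1 t; nra.
have qr_gt0 : 0 < (q - r) * (1 - r ^+ N).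
  by rewrite mulr_gt0 // subr_gt0 // (lt_trans r_lt1).
apply/eqP; rewrite eqr_div ?lt0r_neq0 //.
apply/eqP; rewrite [RHS]mulrC sumE.
by ring: qrN qr1.
Qed.

Lemma sum_poisson_kernel N q r : (0 < N)%N -> 1 < q -> q * r = 1 ->
  \sum_(0 <= j < N) 1 / (q + r - 2 * cos (j%:R * (pi * 2) / N%:R)) =
  N%:R * (1 + r ^+ N) / ((q - r) * (1 - r ^+ N)).
Proof.
move=> N_gt0 q_gt1 qr1.
under eq_bigr => j _ do rewrite (poisson_kernel_expansion _ j _ _ N_gt0 q_gt1 qr1).
(* With j as the inner index, the k = 0 term is N copies of 1 + r^N, and the inner sums for 0 < k <
   N vanish. *)
rewrite -mulr_suml exchange_big /= big_ltn //.
under eq_bigr => j _ do rewrite mul0r cos0 !expr0 !mulr1.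
rewrite sumr_const_nat subn0 mulr_natl [X in _ + X]big_nat big1 ?addr0 // => k kN.
by rewrite -mulr_sumr sum_cos_eq0 ?mulr0.
Qed.

Lemma sum_inv_sqr_sin (x : R) m : 0 < x -> (0 < m)%N ->
  \sum_(0 <= j < 2 * m)
    1 / (x ^+ 2 + 4 * sin (j%:R * pi / (2 * m%:R)) ^+ 2) =
  2 * m%:R * (lucas_poly R (2 * m)).[x] /
    (x * (x ^+ 2 + 4) * (fibonacci_poly R (2 * m)).[x]).
Proof.
move=> x_gt0 m_gt0.
have m_neq0 : m%:R != 0 :> R by rewrite pnatr_eq0 -lt0n.
have N_gt0 : (0 < 2 * m)%N by rewrite muln_gt0.
pose d := Num.sqrt (x ^+ 2 + 4).
have d2 : d ^+ 2 = x ^+ 2 + 4 by rewrite sqr_sqrtr //; nra.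
have d_gt0 : 0 < d by rewrite sqrtr_gt0; nra.
(* The roots of t^2 - x t - 1, whose discriminant is d^2. *)
pose a := (x + d) / 2; pose b := (x - d) / 2.
have abx : a + b = x by rewrite /a /b; field.
have abd : a - b = d by rewrite /a /b; field.
have ab : a * b = -1.
  have -> : a * b = (x ^+ 2 - d ^+ 2) / 4 by rewrite /a /b; field.
  by rewrite d2; field.
have d_gt2 : 2 < d by nra.
have a_gt1 : 1 < a by rewrite /a; lra.
have qr1 : a ^+ 2 * b ^+ 2 = 1 by rewrite -exprMn ab sqrrN expr1n.
have q_gt1 : 1 < a ^+ 2 by nra.
transitivity (\sum_(0 <= j < 2 * m)
    1 / (a ^+ 2 + b ^+ 2 - 2 * cos (j%:R * (pi * 2) / (2 * m)%:R)) : R).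
  apply: eq_bigr => j _; congr (1 / _).
  have -> : j%:R * (pi * 2) / (2 * m)%:R = (j%:R * pi / (2 * m%:R)) *+ 2 :> R.
    by rewrite natrM; field.
  (* Both sides equal x^2 + 2 - 2 cos(2 theta), because a^2 + b^2 = x^2 + 2. *)
  by rewrite cos_mulr2n cos2sin2 -abx; ring: ab.
rewrite sum_poisson_kernel // -[in RHS]abx lucas_poly_binet // abx.
have := fibonacci_poly_binet R a b (2 * m) ab; rewrite abx abd => FE.
have aN_gt1 : 1 < a ^+ (2 * m) by rewrite exprn_egt1 // -lt0n.
(* Evenness of the exponent enters here: for an odd one the product would be -1. *)
have abN : a ^+ (2 * m) * b ^+ (2 * m) = 1 by rewrite -exprMn ab exprM sqrrN !expr1n.
have bN_lt1 : b ^+ (2 * m) < 1 by nra.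
have F_neq0 : (fibonacci_poly R (2 * m)).[x] != 0.
  by rewrite lt0r_neq0 // horner_fibonacci_poly_gt0.
have -> : a ^+ 2 - b ^+ 2 = x * d by rewrite -abx -abd; ring.
rewrite exprAC natrM -d2.
move: FE aN_gt1 abN bN_lt1 F_neq0.
move: (fibonacci_poly _ _).[x] (a ^+ (2 * m)) (b ^+ (2 * m)) => F u v FE u_gt1 uv v_lt1 F_neq0.
have v_gt0 : 0 < v by nra.
have dens_gt0 : 0 < x * d * (1 - v ^+ 2) by rewrite !mulr_gt0 //; nra.
have xdF_neq0 : x * d ^+ 2 * F != 0.
  by rewrite mulf_neq0 // mulf_neq0 ?expf_neq0 // lt0r_neq0.
apply/eqP; rewrite eqr_div ?(lt0r_neq0 dens_gt0) //.
apply/eqP.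
(* With u = a^(2m) and v = b^(2m), u v = 1 exposes u + v as the Lucas value and u - v as F d; the
   common factor v cancels. *)
have -> : 1 + v ^+ 2 = v * (u + v) by ring: uv.
have -> : 1 - v ^+ 2 = v * (F * d) by rewrite FE; ring: uv.
by ring.
Qed.

End CosineSums.

Theorem corollary5p3 (R : realType) (m : nat) (hm : (0 < m)%N) :
  [/\ \sum_(1 <= j < 2 * m)
        1 / (1 / 4 + sin (j%:R * pi / (2 * m%:R)) ^+ 2) =
      4 / 5 * (((2 * m%:R - 1) * (fibonacci (2 * m + 1))%:R
                + (2 * m%:R + 1) * (fibonacci (2 * m - 1))%:R)
               / (fibonacci (2 * m))%:R)
      - 16 / 5 :> R,
      \sum_(0 <= j < 2 * m)
        1 / (1 + 4 * sin (j%:R * pi / (2 * m%:R)) ^+ 2) =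
      2 * m%:R * (lucas (2 * m))%:R / (5 * (fibonacci (2 * m))%:R) :> R
    & \sum_(0 <= j < 2 * m)
        1 / (1 + sin (j%:R * pi / (2 * m%:R)) ^+ 2) =
      m%:R * pell_lucas R (2 * m) / pell R (2 * m) :> R].
Proof.
have m_neq0 : m%:R != 0 :> R by rewrite pnatr_eq0 -lt0n.
have N_gt0 : (0 < 2 * m)%N by rewrite muln_gt0.
have F_neq0 : (fibonacci (2 * m))%:R != 0 :> R.
  by rewrite -horner_fibonacci_poly1 lt0r_neq0 // horner_fibonacci_poly_gt0.
(* The case x = 1, where x (x^2 + 4) = 5. *)
have id2 : \sum_(0 <= j < 2 * m)
    1 / (1 + 4 * sin (j%:R * pi / (2 * m%:R)) ^+ 2) =
    2 * m%:R * (lucas (2 * m))%:R / (5 * (fibonacci (2 * m))%:R) :> R.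
  have := sum_inv_sqr_sin (1 : R) m ltr01 hm.
  rewrite expr1n horner_lucas_poly1 horner_fibonacci_poly1 => ->.
  by congr (_ / _); ring.
split=> //.
(* Scaling each term by 4 reduces to the second identity, whose extra j = 0 term is 1. *)
- have -> : \sum_(1 <= j < 2 * m)
      1 / (1 / 4 + sin (j%:R * pi / (2 * m%:R)) ^+ 2) =
      4 * (\sum_(0 <= j < 2 * m)
        1 / (1 + 4 * sin (j%:R * pi / (2 * m%:R)) ^+ 2) - 1) :> R.
    rewrite [in RHS]big_ltn // !mul0r sin0 expr0n /= mulr0 addr0 divr1.
    rewrite addrC addKr mulr_sumr; apply: eq_bigr => j _.
    have := sqr_ge0 (sin (j%:R * pi / (2 * m%:R)) : R).
    by move: (sin _ ^+ 2) => s s_ge0; field; lra.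
  (* Writing 2m as n + 1 removes the truncated subtraction. The numerator is 2m L_{2m} - F_{2m},
     since L_{2m} = F_{2m+1} + F_{2m-1}. *)
  rewrite id2; case: (2 * m)%N N_gt0 F_neq0 => // n _ F_neq0.
  rewrite lucas_fibonacci addn1 subn1 /= natrD.
  have FE : (fibonacci n.+2)%:R = (fibonacci n.+1)%:R + (fibonacci n)%:R :> R.
    by rewrite -natrD.
  by rewrite FE; field.
(* The case x = 2, where x (x^2 + 4) = 16; each summand gains a factor 4, and the Lucas value is 2
   Q_{2m}. *)
- have := sum_inv_sqr_sin (2 : R) m (ltr0Sn R 1) hm.
  rewrite -/(pell R (2 * m)) => id3.
  have -> : \sum_(0 <= j < 2 * m)
      1 / (1 + sin (j%:R * pi / (2 * m%:R)) ^+ 2) =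
      4 * \sum_(0 <= j < 2 * m)
        1 / (2 ^+ 2 + 4 * sin (j%:R * pi / (2 * m%:R)) ^+ 2) :> R.
    rewrite mulr_sumr; apply: eq_bigr => j _.
    have := sqr_ge0 (sin (j%:R * pi / (2 * m%:R)) : R).
    by move: (sin _ ^+ 2) => s s_ge0; field; lra.
  have P_neq0 : pell R (2 * m) != 0.
    by rewrite lt0r_neq0 // horner_fibonacci_poly_gt0.
  by rewrite id3 /pell_lucas; field.
Qed.
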